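(* Let $\mathcal{G}_b=(\mathcal{V}_b,\mathcal{E}_b)$ be a bipartite graph with edge weights $w:\mathcal{E}_b\to\mathbb{R}$, and let the maximum cardinality matching $\mathcal{M}\in\mathcal{S}(\mathcal{G}_b)$ be a bottleneck assignment of $\mathcal{G}_b$. The edge $e_p\in\mathcal{E}_b$ has positive price of absence, i.e. $P(\mathcal{G}_b,e_p)>0$, if and only if there does not exist an augmenting path in $\psi(\mathcal{G}_b,\mathcal{M})\setminus\{e_p\}$ relative to $\mathcal{M}\setminus\{e_p\}$, where $\psi(\mathcal{G}_b,\mathcal{M})=\{e\in\mathcal{E}_b\mid w(e)\le\max_{e'\in\mathcal{M}}w(e')\}$ is the matching-sublevel set.
   Context: Setting: $\mathcal{G}_b=(\mathcal{V}_b,\mathcal{E}_b)$ is an undirected bipartite graph with $\mathcal{V}_b=\mathcal{A}_b\cup\mathcal{B}_b$, $\mathcal{A}_b\cap\mathcal{B}_b=\emptyset$, $\mathcal{E}_b\subseteq\{\{i,j\}\mid i\in\mathcal{A}_b,j\in\mathcal{B}_b\}$ ($\mathcal{A}_b$ is a set of agents, $\mathcal{B}_b$ a set of tasks), and weights $w:\mathcal{E}_b\to\mathbb{R}$. A matching is a set of edges such that no vertex is incident to more than one of them; a maximum cardinality matching (MCM) is a matching of maximum cardinality. $\mathcal{C}(\mathcal{G})$ is the set of MCMs of $\mathcal{G}$ and $\mathcal{F}(\mathcal{G})$ is the cardinality of an MCM of $\mathcal{G}$. Bottleneck weight: $\mathcal{W}(\mathcal{G})=\min_{\mathcal{M}\in\mathcal{C}(\mathcal{G})}\max_{e\in\mathcal{M}}w(e)$.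 Set of bottleneck assignments: $\mathcal{S}(\mathcal{G})=\{\mathcal{M}\in\mathcal{C}(\mathcal{G})\mid\max_{e\in\mathcal{M}}w(e)=\mathcal{W}(\mathcal{G})\}$. Price of absence: for $e\in\mathcal{E}_b$, $P(\mathcal{G}_b,e)=\mathcal{W}((\mathcal{V}_b,\mathcal{E}_b\setminus\{e\}))-\mathcal{W}((\mathcal{V}_b,\mathcal{E}_b))$ if $\mathcal{F}((\mathcal{V}_b,\mathcal{E}_b))=\mathcal{F}((\mathcal{V}_b,\mathcal{E}_b\setminus\{e\}))$, and $P(\mathcal{G}_b,e)=+\infty$ otherwise. Paths: a path between $v_1$ and $v_{l+1}$ is a set of edges $\{\{v_k,v_{k+1}\}\mid k\in\{1,\dots,l\}\}$ with $v_1,\dots,v_{l+1}$ distinct vertices, consecutive ones being adjacent. A path $\mathcal{P}$ is alternating relative to a matching $\mathcal{N}$ if and only if each vertex incident to an edge of $\mathcal{P}$ is incident to no more than one edge of $\mathcal{P}\cap\mathcal{N}$ and no more than one edge of $\mathcal{P}\setminus\mathcal{N}$. A vertex is free relative to $\mathcal{N}$ if and only if it is incident to no edge of $\mathcal{N}$. A path $\mathcal{P}$ between $v_1$ and $v_{l+1}$ is augmenting relative to $\mathcal{N}$ if and only if it is alternating relative to $\mathcal{N}$ and $v_1$ and $v_{l+1}$ are both free relative to $\mathcal{N}$.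
   Formalization: The right-hand side additionally requires that e_p belong to M: for every edge e_p outside M the price of absence is 0 although no augmenting path exists, so the equivalence as written fails there; paths are taken to have at least one edge. *)

(* Defs.v *)
From mathcomp Require Import all_boot all_order all_algebra.
From mathcomp Require Import reals constructive_ereal.
Set Implicit Arguments.
Unset Strict Implicit.
Unset Printing Implicit Defensive.
Import Order.TTheory GRing.Theory Num.Theory.

Local Open Scope ring_scope.

(* An undirected edge {i, j} is the set [set i; j]; a graph is represented by
   its set of edges E : {set {set T}}. The vertex set is left implicit: it does
   not change when an edge is deleted, and nothing below depends on isolated
   vertices. *)

Definition bipartite (T : finType) (A B : {set T}) (E : {set {set T}}) : Prop :=
  [disjoint A & B] /\
  forall e, e \in E -> exists i j, [/\ i \in A, j \in B & e = [set i; j]].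

Definition matching (T : finType) (E M : {set {set T}}) : bool :=
  (M \subset E) && [forall v : T, (#|[set e in M | v \in e]| <= 1)%N].

Definition mcm_card (T : finType) (E : {set {set T}}) : nat :=
  \max_(M : {set {set T}} | matching E M) #|M|.

Definition mcms (T : finType) (E : {set {set T}}) : {set {set {set T}}} :=
  [set M | matching E M & #|M| == mcm_card E].

(* Maxima and minima are taken in the extended reals, so that the maximum over
   the empty matching is -oo; for a nonempty matching this is the usual maximum.
   Weights are total functions whose values outside E are never used. *)
Definition max_weight (R : realType) (T : finType) (w : {set T} -> R)
    (M : {set {set T}}) : \bar R :=
  \big[Order.max/-oo%E]_(e in M) (w e)%:E.

Definition bottleneck_weight (R : realType) (T : finType) (w : {set T} -> R)
    (E : {set {set T}}) : \bar R :=
  \big[Order.min/+oo%E]_(M in mcms E) max_weight w M.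

Definition bottleneck_assignments (R : realType) (T : finType)
    (w : {set T} -> R) (E : {set {set T}}) : {set {set {set T}}} :=
  [set M in mcms E | max_weight w M == bottleneck_weight w E].

(* In the first branch both bottleneck weights are finite as soon as e \in E:
   the maximum matchings of E and of E :\ e are then nonempty. *)
Definition price_of_absence (R : realType) (T : finType) (w : {set T} -> R)
    (E : {set {set T}}) (e : {set T}) : \bar R :=
  if mcm_card E == mcm_card (E :\ e)
  then (bottleneck_weight w (E :\ e) - bottleneck_weight w E)%E
  else +oo%E.

Definition sublevel (R : realType) (T : finType) (w : {set T} -> R)
    (E M : {set {set T}}) : {set {set T}} :=
  [set e in E | ((w e)%:E <= max_weight w M)%E].

(* P is the edge set of a simple path from u to v; the vertices of the path are
   u :: s, and s != [::] says that it has at least one edge. *)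
Definition path_between (T : finType) (E P : {set {set T}}) (u v : T) : Prop :=
  exists s : seq T,
    [/\ s != [::], uniq (u :: s), last u s = v,
        path (fun x y => [set x; y] \in E) u s
      & P = [set:: pairmap (fun x y => [set x; y]) u s]].

Definition alternating (T : finType) (N P : {set {set T}}) : Prop :=
  forall v : T, (exists2 e, e \in P & v \in e) ->
    (#|[set e in P :&: N | v \in e]| <= 1)%N /\
    (#|[set e in P :\: N | v \in e]| <= 1)%N.

Definition free (T : finType) (N : {set {set T}}) (v : T) : Prop :=
  forall e, e \in N -> v \notin e.

Definition augmenting_path (T : finType) (E N P : {set {set T}}) : Prop :=
  exists u v : T,
    [/\ path_between E P u v, alternating N P, free N u & free N v].

(* Main.v *)
(* The price of absence of [ep] is positive exactly when the sublevel set without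
   [ep] contains no matching of cardinality [#|M|]. If [ep] is not in [M], then
   [M] is such a matching. Otherwise [M :\ ep] is one edge short of that
   cardinality, so by Berge's theorem such a matching exists if and only if
   [M :\ ep] has an augmenting path. *)
Require Import Defs.
From mathcomp Require Import all_boot all_order all_algebra.
From mathcomp Require Import reals constructive_ereal.
Set Implicit Arguments.
Unset Strict Implicit.
Unset Printing Implicit Defensive.
Import Order.TTheory.

(** * Matchings, alternating paths and Berge's theorem *)

Section Berge.
Variable T : finType.
Implicit Types (E M N P : {set {set T}}) (e f : {set T}) (x y u v : T).

Local Notation edge := (fun x y => [set x; y]).

Lemma card_le1_setP (D : {set {set T}}) x :
  reflect {in D &, forall e f, x \in e -> x \in f -> e = f}
          (#|[set e in D | x \in e]| <= 1).
Proof.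
apply: (iffP card_le1_eqP) => h e f.
  by move=> eD fD xe xf; apply: h; rewrite inE ?eD ?fD.
by rewrite !inE => /andP[eD xe] /andP[fD xf]; apply: h.
Qed.

Lemma matchingP E M :
  reflect (M \subset E /\
           forall x, {in M &, forall e f, x \in e -> x \in f -> e = f})
          (matching E M).
Proof.
apply: (iffP andP) => -[ME h]; split=> //.
  by move=> x; apply/card_le1_setP; apply/(forallP h).
by apply/forallP => x; apply/card_le1_setP; apply: h.
Qed.

Lemma matching_sub E E' M : M \subset E' -> matching E M -> matching E' M.
Proof. by move=> ME' /matchingP[_ h]; apply/matchingP. Qed.

Lemma matching_subset E M N : N \subset M -> matching E M -> matching E N.
Proof.
move=> NM /matchingP[ME h]; apply/matchingP; split.
  exact: subset_trans ME.
by move=> x e f /(subsetP NM) eM /(subsetP NM) fM; apply: h.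
Qed.

Lemma matching_card_le E M : matching E M -> #|M| <= mcm_card E.
Proof. by move=> ?; apply: (leq_bigmax_cond (F := fun M => #|M|)). Qed.

Lemma mcm_card_sub E E' : E' \subset E -> mcm_card E' <= mcm_card E.
Proof.
move=> sE; apply/bigmax_leqP => M mM; apply: matching_card_le.
apply: (matching_sub _ mM); case/matchingP: mM => ME _.
exact: subset_trans sE.
Qed.

(** The edges of a matching are disjoint pairs; sizes of matchings can thus be compared through the
    vertices they cover. *)
Lemma card_cover_matching E M :
  {in E, forall e, #|e| = 2} -> matching E M -> #|cover M| = #|M| * 2.
Proof.
move=> E2 /matchingP[ME h].
have /eqP <- : trivIset M.
  apply/trivIsetP => e f eM fM; apply: contraNT.
  by rewrite -setI_eq0 => /set0Pn[x /setIP[xe xf]]; apply/eqP/(h x).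
rewrite -sum_nat_const; apply: eq_bigr => e eM.
by rewrite E2 // (subsetP ME).
Qed.

Lemma edge_in_pairmap u (s1 : seq T) y s2 :
  [set last u s1; y] \in pairmap edge u (s1 ++ y :: s2).
Proof. by rewrite pairmap_cat mem_cat /= mem_head orbT. Qed.

Lemma pairmap_edge_vertex u s e x :
  e \in pairmap edge u s -> x \in e -> x \in u :: s.
Proof.
elim: s u => //= y s IH u; rewrite !inE => /orP[/eqP->|/IH h /h].
  by rewrite !inE => /orP[]->; rewrite ?orbT.
by rewrite inE => ->; rewrite orbT.
Qed.

Lemma pairmap_edge_sub E u s :
  path (fun x y => [set x; y] \in E) u s ->
  [set:: pairmap edge u s] \subset E.
Proof.
move=> us; apply/subsetP => e; rewrite inE.
elim: s u us => //= y s IH u /andP[uyE ys].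
by rewrite inE => /orP[/eqP->|/(IH _ ys)].
Qed.

(** Such an [x] has a predecessor and a successor on the path; the two edges differ because the
    successor does not occur earlier. *)
Lemma path_inner_edges u s x :
  uniq (u :: s) -> x \in s -> x != last u s ->
  exists e f, [/\ e \in pairmap edge u s, f \in pairmap edge u s,
    x \in e, x \in f & e != f].
Proof.
move=> us xs; case/splitPr: xs us => s1 s2; case: s2 => [|y s2].
  by rewrite last_cat /= eqxx.
rewrite -cat_cons cat_uniq => /and3P[_ /hasPn h1 /andP[xNs2 _]] _.
have /h1/= yNs1 : y \in x :: y :: s2 by rewrite !inE eqxx orbT.
have xy : x != y by apply: contraNneq xNs2 => ->; apply: mem_head.
exists [set last u s1; x], [set x; y]; split; rewrite ?set21 ?set22 //.
- exact: edge_in_pairmap.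
- have := edge_in_pairmap u (rcons s1 x) y s2.
  by rewrite last_rcons cat_rcons.
- apply/eqP => /setP/(_ y); rewrite set22 !inE [y == x]eq_sym (negPf xy) orbF.
  by move=> /eqP yl; move: yNs1; rewrite yl mem_last.
Qed.

(* The larger matching is the symmetric difference of [N] and [P]; it covers every
   vertex covered by [N] and, in addition, both ends of the path. *)
Lemma augmenting_larger_matching E N P :
  {in E, forall e, #|e| = 2} -> matching E N -> augmenting_path E N P ->
  exists2 M, matching E M & #|N| < #|M|.
Proof.
move=> E2 mN [u [v [[s [s0 us lasts pE defP]] altP Fu Fv]]].
have [NE hN] := matchingP _ _ mN.
have PE : P \subset E by rewrite defP pairmap_edge_sub.
have inP e : (e \in P) = (e \in pairmap edge u s) by rewrite defP inE.
have onP x e : e \in P -> x \in e ->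
    {in P :&: N &, forall e f, x \in e -> x \in f -> e = f} /\
    {in P :\: N &, forall e f, x \in e -> x \in f -> e = f}.
  move=> eP xe; have [|? ?] := altP x; first by exists e.
  by split; apply/card_le1_setP.
(* Two path edges meet at an inner vertex, and alternation allows at most one of them in [N] and at
   most one outside. *)
have inner x : x \in u :: s -> x != u -> x != v ->
    (exists2 e, e \in P :&: N & x \in e) /\ (exists2 e, e \in P :\: N & x \in e).
  rewrite inE => /orP[->//|xs] _ xv.
  have [|e [f [eP fP xe xf nef]]] := path_inner_edges us xs; first by rewrite lasts.
  rewrite -!inP in eP fP.
  have [h1 h2] := onP x e eP xe.
  case: (boolP (e \in N)) (boolP (f \in N)) => eN [] fN.
  - by case/eqP: nef; apply: h1; rewrite ?inE ?eP ?fP.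
  - by split; [exists e | exists f]; rewrite ?inE ?eP ?fP ?eN ?fN.
  - by split; [exists f | exists e]; rewrite ?inE ?eP ?fP ?eN ?fN.
  - by case/eqP: nef; apply: h2; rewrite ?inE ?eP ?fP ?eN ?fN.
(* At the ends [u] and [v] the path edge is outside [N] because both are free. *)
have coverP x : x \in u :: s -> exists2 e, e \in P :\: N & x \in e.
  move=> xs; have [->|xu] := eqVneq x u.
    case: (s) s0 inP => // y s' _ inP.
    have uyP : [set u; y] \in P by rewrite inP (edge_in_pairmap u [::]).
    exists [set u; y]; rewrite ?set21 // inE uyP andbT.
    by apply/negP => /Fu; rewrite set21.
  have [->|xv] := eqVneq x v; last by case: (inner x xs xu xv).
  case/lastP: (s) s0 lasts inP => // s' y _; rewrite last_rcons => -> inP.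
  have eP : [set last u s'; v] \in P by rewrite inP -cats1 edge_in_pairmap.
  exists [set last u s'; v]; rewrite ?set22 // inE eP andbT.
  by apply/negP => /Fv; rewrite set22.
have vertexP x e : e \in P -> x \in e -> x \in u :: s.
  by rewrite inP; apply: pairmap_edge_vertex.
pose M := (N :\: P) :|: (P :\: N).
(* A vertex shared by [e] and [f] is on the path and covered by [N], hence inner; its edge in
   [P :&: N] would have to be [e], which is not in [P]. *)
have mixed x e f : e \in N :\: P -> f \in P :\: N -> x \in e -> x \in f -> e = f.
  move=> /setDP[eN eNP] /setDP[fP fNN] xe xf.
  have [||[g /setIP[gP gN] xg] _] := inner x (vertexP _ _ fP xf).
  - by apply/eqP => xu; move: (Fu e eN); rewrite -xu xe.
  - by apply/eqP => xv; move: (Fv e eN); rewrite -xv xe.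
  - by move: eNP; rewrite (hN x e g) ?gP.
have mM : matching E M.
  apply/matchingP; split.
    by rewrite subUset !subDset !subsetU ?NE ?PE ?orbT.
  move=> x e f /setUP[] eM /setUP[] fM xe xf.
  - by case/setDP: eM fM => eN _ /setDP[fN _]; apply: (hN x).
  - exact: (mixed x).
  - by apply/esym/(mixed x).
  - have [_] := onP x e (subsetP (subsetDl _ _) _ eM) xe; exact.
exists M => //.
have vs : v \in u :: s by rewrite -lasts mem_last.
have covM x : x \in u :: s -> x \in cover M.
  by case/coverP => e eP xe; apply/bigcupP; exists e => //; apply/setUP; right.
have sub : u |: (v |: cover N) \subset cover M.
  rewrite !subUset !sub1set !covM ?mem_head //=.
  apply/subsetP => x /bigcupP[e eN xe].
  have [eP|eNP] := boolP (e \in P); first exact: covM (vertexP _ _ eP xe).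
  by apply/bigcupP; exists e => //; rewrite !inE eNP eN.
have FC x : Defs.free N x -> x \notin cover N.
  by move=> Fx; apply/bigcupP => -[e /Fx/negP].
have uv : u != v.
  apply/eqP => uv; case/lastP: (s) s0 us lasts => // s' y _.
  by rewrite last_rcons -uv => us yu; move: us; rewrite yu /= mem_rcons mem_head.
(* [cover M] has at least two vertices more than [cover N]; halving gives one more edge. *)
have := subset_leq_card sub.
rewrite !cardsU1 !inE negb_or uv !FC //= (card_cover_matching E2 mM).
rewrite (card_cover_matching E2 mN) addnA -[1 + 1]/(1 * 2) -mulnDl leq_pmul2r //.
Qed.

(* Strip from [M] an edge [a b] whose end [a] is exposed by [N], and from [N]
   the edge [b c] if there is one: a path found for the remaining matchings
   avoids [a] and [b], so it either still works or is prolonged from [c] through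
   [b] to [a]. *)
Lemma larger_matching_path E M N :
  {in E, forall e, #|e| = 2} -> matching E M -> matching E N -> #|N| < #|M| ->
  exists u s, [/\ s != [::], uniq (u :: s),
    path (fun x y => [set x; y] \in N :|: M) u s,
    u \notin cover N & last u s \notin cover N].
Proof.
move=> E2; have [n leMn] := ubnP #|M|.
elim: n M N leMn => // n IH M N leMn mM mN ltNM.
have [[ME hM] [NE hN]] := (matchingP _ _ mM, matchingP _ _ mN).
(* [M] covers more vertices than [N], which supplies the exposed end [a]. *)
have : ~~ (cover M \subset cover N).
  apply: contraL ltNM => /subset_leq_card.
  by rewrite !(card_cover_matching E2) // leq_pmul2r // -leqNgt.
case/subsetPn => a /bigcupP[e eM ae] aN.
have other x f : f \in E -> x \in f -> exists2 y, x != y & f = [set x; y].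
  move=> fE xf; have /eqP/cards2P[y [z [yz def_f]]] := E2 f fE.
  move: xf; rewrite def_f !inE => /orP[]/eqP->; first by exists z.
  by exists y; [rewrite eq_sym | rewrite setUC].
have [b ab def_e] := other a e (subsetP ME _ eM) ae.
have abM : [set a; b] \in M by rewrite -def_e.
have [bN|bN] := boolP (b \in cover N); last first.
  by exists a, [:: b]; rewrite /= !inE ab abM orbT.
case/bigcupP: bN => f fN bf.
have [c bc def_f] := other b f (subsetP NE _ fN) bf.
have bcN : [set b; c] \in N by rewrite -def_f.
have aNf g : g \in N -> a \notin g.
  by move=> gN; apply: contra aN => ag; apply/bigcupP; exists g.
have ac : a != c by apply: contraTneq (aNf _ bcN) => ->; rewrite set22.
pose M' := M :\ e; pose N' := N :\ f.
have cM : #|M| = #|M'|.+1 by rewrite (cardsD1 e) eM.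
have cN : #|N| = #|N'|.+1 by rewrite (cardsD1 f) fN.
have [|||| u [s [s0 us pus uN lN]]] := IH M' N'.
- by rewrite cM in leMn.
- by apply: matching_subset mM; rewrite subsetDl.
- by apply: matching_subset mN; rewrite subsetDl.
- by rewrite cM cN in ltNM.
have sub : N' :|: M' \subset N :|: M by rewrite setUSS ?subsetDl.
have pus' : path (fun x y => [set x; y] \in N :|: M) u s.
  by apply: sub_path pus => x y; apply: (subsetP sub).
(* In [N :|: M] only [e] meets [a], and only [e] and [f] meet [b]; each vertex of the path lies on a
   remaining edge since [s] is nonempty. *)
have avoid x : x \in u :: s -> (x != a) && (x != b).
  have avoid2 y z : [set y; z] \in N' :|: M' ->
      [&& y != a, y != b, z != a & z != b].
    have nin g : g \in N' :|: M' -> (a \notin g) && (b \notin g).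
      rewrite !inE => /orP[]/andP[/eqP ne gX].
        rewrite aNf //=; apply/negP => bg; apply: ne; exact: (hN b).
      apply/andP; split; apply/negP => hg; apply: ne.
        exact: (hM a).
      by apply: (hM b) => //; rewrite def_e set22.
    move/nin; rewrite !inE !negb_or ![a == _]eq_sym ![b == _]eq_sym.
    by case/andP=> /andP[-> ->] /andP[-> ->].
  elim: (s) (u) s0 pus => // y s' IHs u' _ /= /andP[/avoid2/and4P[ua ub ya yb]].
  case: s' IHs => [_ _|z s' IHs pz].
    by rewrite !inE => /orP[]/eqP->; apply/andP.
  by rewrite inE => /orP[/eqP->|/(IHs y isT pz)//]; apply/andP.
(* Restoring [f] covers only [b] and [c], and the path avoids [b], so only [c] can cease to be
   exposed. *)
have stillfree x : x \in u :: s -> x \notin cover N' -> x != c -> x \notin cover N.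
  move=> /avoid/andP[xa xb] xN' xc; apply: contra xN' => /bigcupP[g gN xg].
  apply/bigcupP; exists g => //; rewrite !inE gN andbT.
  by apply: contraTneq xg => ->; rewrite def_f !inE negb_or xb.
have notin x : (x == a) || (x == b) -> x \notin u :: s.
  by move=> h; apply/negP => /avoid; rewrite -negb_or h.
have aus : a \notin u :: s by rewrite notin ?eqxx.
have bus : b \notin u :: s by rewrite notin ?eqxx ?orbT.
have lus := mem_last u s.
(* Since the ends differ, [c] is at most one of them and a single prolongation suffices. *)
have ul : u != last u s.
  case/lastP: (s) s0 us => // s' y _ /andP[+ _]; rewrite last_rcons.
  by apply: contraNneq => ->; rewrite mem_rcons mem_head.
have [uc|uc] := eqVneq u c.
  exists a, [:: b, u & s]; split=> //=.
  - by rewrite inE negb_or ab aus bus.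
  - by rewrite [in [set b; u]]uc !inE abM bcN orbT.
  - by apply: stillfree => //; rewrite -uc eq_sym.
have [lc|lc] := eqVneq (last u s) c; last first.
  by exists u, s; split=> //; apply: stillfree; rewrite ?mem_head.
exists u, (s ++ [:: b; a]); split=> //.
- by case: (s) s0.
- rewrite -cat_cons cat_uniq us andTb; apply/andP; split.
    by apply/hasPn => x; rewrite !inE orbC => /notin.
  by rewrite /= inE eq_sym ab.
- by rewrite cat_path pus' /= lc !inE [[set c; b]]setUC [[set b; a]]setUC bcN abM
    orbT.
- by apply: stillfree; rewrite ?mem_head.
- by rewrite last_cat.
Qed.

Theorem Berge E N :
  {in E, forall e, #|e| = 2} -> matching E N ->
  (exists P, augmenting_path E N P) <->
  (exists2 M, matching E M & #|N| < #|M|).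
Proof.
move=> E2 mN; split=> [[P]|[M mM ltNM]]; first exact: augmenting_larger_matching.
have [u [s [s0 us pus uN lN]]] := larger_matching_path E2 mM mN ltNM.
have [[ME hM] [NE hN]] := (matchingP _ _ mM, matchingP _ _ mN).
exists [set:: pairmap edge u s], u, (last u s); split.
- exists s; split=> //; apply: sub_path pus => x y.
  by apply/subsetP; rewrite subUset NE ME.
(* The path uses only edges of [N] and [M], so its edges outside [N] belong to the matching [M];
   this gives alternation. *)
- have /subsetP PNM := pairmap_edge_sub pus.
  move=> x _; split; apply/card_le1_setP => e f.
    by move=> /setIP[_ eN] /setIP[_ fN]; apply: (hN x).
  move=> /setDP[/PNM/setUP[->//|eM] _] /setDP[/PNM/setUP[->//|fM] _].
  exact: (hM x).
- by move=> e eN; apply: contra uN => ue; apply/bigcupP; exists e.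
- by move=> e eN; apply: contra lN => le; apply/bigcupP; exists e.
Qed.

End Berge.

(** * Bottleneck weights and the price of absence *)

Section Weights.
Variables (R : realType) (T : finType) (w : {set T} -> R).
Implicit Types (E M : {set {set T}}) (e : {set T}).

Lemma bipartite_card2 (A B : {set T}) E :
  bipartite A B E -> {in E, forall e, #|e| = 2}.
Proof.
move=> [dAB hE] e /hE[i [j [iA jB ->]]]; rewrite cards2.
by case: eqVneq => // ij; have := disjointFr dAB iA; rewrite ij jB.
Qed.

Lemma max_weight_lty M : (max_weight w M < +oo)%E.
Proof. by apply/bigmax_ltP; split=> // e _; rewrite ltry. Qed.

(** Trades weights for inclusions; an empty [M'] is no exception, its weight being [-oo]. *)
Lemma max_weight_le_sublevel E M M' : M' \subset E ->
  (max_weight w M' <= max_weight w M)%E = (M' \subset sublevel w E M).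
Proof.
move=> /subsetP M'E; apply/bigmax_leP/subsetP => [[_ h] e eM'|h].
  by rewrite inE M'E //= h.
by split=> [|e /h]; rewrite ?leNye // inE => /andP[].
Qed.

Lemma price_of_absence_gt0 E M ep :
  M \in bottleneck_assignments w E ->
  (0 < price_of_absence w E ep)%E <->
  ~ exists2 M', matching (sublevel w E M :\ ep) M' & #|M'| = #|M|.
Proof.
rewrite !inE => /andP[/andP[mM /eqP cM] /eqP wM].
have SE : sublevel w E M :\ ep \subset E :\ ep.
  by rewrite setSD //; apply/subsetP => e; rewrite inE => /andP[].
rewrite /price_of_absence -wM; case: eqP => [eqE|neE]; last first.
  rewrite ltry; split=> // _ [M' mM' cM']; apply: neE; apply/eqP.
  rewrite eqn_leq (mcm_card_sub (subsetDl _ _)) andbT -cM -cM'.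
  by apply/matching_card_le/(matching_sub _ mM'); case/andP: mM' => /subset_trans->.
(* The two cardinalities agree, so the candidates are the matchings of [E :\ ep] of size [#|M|], and
   the price is positive when all of them outweigh [M]. *)
rewrite sube_gt0; split=> [/bigmin_gtP[_ h] [M' mM' cM']|h].
  have M'S : M' \subset sublevel w E M :\ ep by case/andP: mM'.
  have := h M'; rewrite inE cM' cM eqE eqxx andbT.
  rewrite (matching_sub (subset_trans M'S SE) mM') => /(_ isT).
  have M'E := subset_trans M'S (subset_trans SE (subsetDl _ _)).
  by rewrite ltNge (max_weight_le_sublevel _ M'E) (subset_trans M'S (subsetDl _ _)).
(* [+oo], the default of the minimum, must exceed the weight of [M] too. *)
apply/bigmin_gtP; split=> [|M']; first exact: max_weight_lty.
rewrite inE => /andP[mM' /eqP cM']; rewrite ltNge; apply/negP => le.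
have M'E : M' \subset E :\ ep by case/andP: mM'.
apply: h; exists M'; last by rewrite cM' cM.
apply: matching_sub mM'; move: M'E; rewrite !subsetD1 => /andP[M'E ->].
by rewrite -max_weight_le_sublevel // le.
Qed.

End Weights.

(** The conjunct [ep \in M] cannot be dropped: if [ep] is outside [M], then [M :\ ep] is the maximum
    matching [M], which has no augmenting path, while the price is not positive. *)
Theorem theorem1 (R : realType) (T : finType) (A B : {set T})
    (E : {set {set T}}) (w : {set T} -> R) (M : {set {set T}}) (ep : {set T})
    (hG : bipartite A B E)
    (hM : M \in bottleneck_assignments w E)
    (hep : ep \in E) :
  (0 < price_of_absence w E ep)%E <->
  (ep \in M /\
   ~ exists P : {set {set T}},
       augmenting_path (sublevel w E M :\ ep) (M :\ ep) P).
Proof.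
have /setIdP[/setIdP[mM /eqP cM] _] := hM.
have ME : M \subset E by case/andP: mM.
have MS : M \subset sublevel w E M by rewrite -max_weight_le_sublevel.
set S := sublevel w E M :\ ep.
have SE : S \subset E by apply/subsetP => e; rewrite !inE => /and3P[].
rewrite (price_of_absence_gt0 ep hM) -/S.
have [epM|epM] := boolP (ep \in M); last first.
  split=> [[]|[]//]; exists M => //.
  by apply: matching_sub mM; rewrite subsetD1 MS.
have mN : matching S (M :\ ep).
  by apply: (matching_sub (setSD _ MS)); apply: matching_subset mM; apply: subsetDl.
have S2 : {in S, forall e : {set T}, #|e| = 2}.
  by move=> e /(subsetP SE); apply: bipartite_card2 hG e.
have cN : #|M| = #|M :\ ep|.+1 by rewrite (cardsD1 ep) epM.
rewrite (Berge S2 mN) -cN.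
(* A matching of [S] is also one of [E], so exceeding [#|M :\ ep|] means having exactly [#|M|]
   edges. *)
have bigM M' : matching S M' -> #|M'| <= #|M|.
  move=> mM'; rewrite cM; apply/matching_card_le/(matching_sub _ mM').
  by case/andP: mM' => /subset_trans->.
split=> [h|[_ h] [M' mM' eM']]; last by apply: h; exists M'; rewrite ?eM'.
split=> // -[M' mM' leM']; apply: h; exists M' => //.
by apply/eqP; rewrite eqn_leq bigM.
Qed.
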